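(* Let $p$ be a prime, $n$ a positive integer with $p\mid n$, and $G=\mathbb{Z}_p\times\mathbb{Z}_n$. Let $d_1,\dots,d_k$ be all the divisors of $n$, ordered so that $d_1,\dots,d_r$ are those divisible by $p^2$ ($r$ may be $0$), $d_{r+1},\dots,d_{r+t}$ are those divisible by $p$ but not by $p^2$, and $d_{r+t+1},\dots,d_k$ are those relatively prime to $p$. Let $S_1,\dots,S_l$, with $l=pr+(p+1)t+(k-r-t)$, be the list of all cyclic subgroups of $G$. Then $$\psi(A(\mathscr{P}(G)),x)=(1+x)^{\alpha}\,\psi(Q,x),$$ where $$\alpha=p\sum_{i=1}^{r}(\phi(d_i)-1)+(p+1)\sum_{i=r+1}^{r+t}(\phi(d_i)-1)+\sum_{i=r+t+1}^{k}(\phi(d_i)-1)$$ and $Q=(q_{ij})_{l\times l}$ with $$q_{ij}=\begin{cases}\phi(|S_j|)&\text{if } i\neq j\text{ and }T_{S_i}\sim T_{S_j},\\ \phi(|S_i|)-1&\text{if } i=j,\\ 0&\text{otherwise.}\end{cases}$$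
   Context: For a finite group $G$, the power graph $\mathscr{P}(G)$ is the simple graph with vertex set $G$ in which two distinct vertices $x,y$ are adjacent iff $x=y^k$ or $y=x^k$ for some $k\in\mathbb{N}$. $A(H)$ is the adjacency matrix of a graph $H$; for a square matrix $N$, $\psi(N,x)=\det(xI-N)$. $\phi$ is Euler's totient function. For a cyclic subgroup $C$, $T_C$ denotes the set of all generators of $C$. For disjoint vertex sets $X,Y$, $X\sim Y$ means every vertex of $X$ is adjacent to every vertex of $Y$ (in $\mathscr{P}(G)$). The list $S_1,\dots,S_l$ contains each cyclic subgroup of $G$ exactly once; its order is immaterial, since reordering conjugates $Q$ by a permutation matrix. *)

(* Defs.v *)
From HB Require Import structures.
From mathcomp Require Import all_boot all_order all_algebra all_fingroup all_solvable.

Set Implicit Arguments.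
Unset Strict Implicit.
Unset Printing Implicit Defensive.

Import GRing.Theory.
Local Open Scope ring_scope.

(* The group law is componentwise addition modulo p and n. This is Z_p x Z_n
   only for 1 < p and 1 < n, since 'Z_0 and 'Z_1 are both Z/2. *)
Definition ZpxZn (p n : nat) : finGroupType := ('Z_p * 'Z_n)%type.

Record sgraph := SGraph {
  vertex :> finType;
  adj : rel vertex;
  adj_sym : symmetric adj;
  adj_irrefl : irreflexive adj }.

Definition adjacency_matrix (H : sgraph) : 'M[int]_#|H| :=
  \matrix_(i, j) (adj (enum_val i : H) (enum_val j))%:R.

(* For sets of vertices X and Y: X ~ Y. *)
Definition fully_adjacent (H : sgraph) (X Y : {set H}) : bool :=
  [forall x in X, forall y in Y, adj x y].

Section PowerGraph.
Variable gT : finGroupType.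

Definition power_adj : rel gT :=
  fun x y => (x != y) && ((x \in <[y]>%g) || (y \in <[x]>%g)).

Lemma power_adjP (x y : gT) :
  reflect (x <> y /\ ((exists k : nat, x = (y ^+ k)%g) \/
                      (exists k : nat, y = (x ^+ k)%g)))
          (power_adj x y).
Proof.
apply: (iffP andP) => [[/eqP nxy adj_xy]|[/eqP nxy H]]; split=> //.
  by case/orP: adj_xy => /cycleP[k E]; [left | right]; exists k.
by case: H => -[k ->]; rewrite mem_cycle ?orbT.
Qed.

Lemma power_adj_sym : symmetric power_adj.
Proof. by move=> x y; rewrite /power_adj eq_sym orbC. Qed.

Lemma power_adj_irrefl : irreflexive power_adj.
Proof. by move=> x; rewrite /power_adj eqxx. Qed.

Definition power_graph : sgraph := SGraph power_adj_sym power_adj_irrefl.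

Definition generators (C : {group gT}) : {set power_graph} :=
  [set x | generator C x].

Definition quotient_matrix (l : nat) (S : 'I_l -> {group gT}) : 'M[int]_l :=
  \matrix_(i, j)
    if (i != j) && fully_adjacent (generators (S i)) (generators (S j))
    then (totient #|S j|)%:R
    else if i == j then (totient #|S i|)%:R - 1
    else 0.

End PowerGraph.

(* Indices start at 0: positions i < r, r <= i < r + t and r + t <= i hold the
   d_i divisible by p ^ 2, by p only, and prime to p. The differences in nat
   are exact, as the totient of a positive number is positive. *)
Definition alpha (p k r t : nat) (d : 'I_k -> nat) : nat :=
  (p * (\sum_(i < k | i < r) (totient (d i) - 1))
   + (p + 1) * (\sum_(i < k | r <= i < r + t) (totient (d i) - 1))
   + \sum_(i < k | r + t <= i) (totient (d i) - 1))%N.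

(* Main.v *)
(** Adding the identity to both matrices makes adjacency depend only on the
cyclic subgroups generated by the vertices: A + I = U V and Q + I = V U, where
U is the incidence matrix between elements and the subgroups they generate, and
V records comparability under inclusion. Hence, with y = 1 + x, the identity
y^l det(y I - U V) = y^|G| det(y I - V U) gives the theorem with exponent
|G| - l. Since Z_p x Z_n has c(m) phi(m) elements of order m for m | n, with
c(m) = p, p + 1 or 1 according to whether p^2 | m, only p | m, or neither, it
has c(m) cyclic subgroups of order m; summing over m | n computes l and
|G| - l. *)

Require Import Defs.
From mathcomp Require Import all_boot all_order all_algebra all_fingroup all_solvable.
From mathcomp Require Import zify.

Set Implicit Arguments.
Unset Strict Implicit.
Unset Printing Implicit Defensive.

Import GRing.Theory.
Local Open Scope ring_scope.

(** * Characteristic matrices of [U *m V] and [V *m U] *)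

Lemma det_scalar_sub_mulmxC (R : comNzRingType) (m n : nat)
    (U : 'M[R]_(m, n)) (V : 'M[R]_(n, m)) (y : R) :
  y ^+ n * \det (y%:M - U *m V) = y ^+ m * \det (y%:M - V *m U).
Proof.
(* Clearing the block [V] of [M] by a right factor leaves [y - U V], by a left factor [y - V U];
   neither divides by [y]. *)
pose M : 'M[R]_(m + n) := block_mx y%:M U V 1%:M.
have detM : \det M = \det (y%:M - U *m V).
  have <- : \det (M *m block_mx 1%:M 0 (- V) 1%:M) = \det M.
    by rewrite det_mulmx det_lblock !det1 !mulr1.
  rewrite mulmx_block !mulmx1 !mul1mx !mulmxN !mulmx0 !add0r subrr.
  by rewrite det_ublock det1 mulr1.
have {1}<- : \det (block_mx 1%:M 0 (- V) y%:M : 'M[R]_(m + n)) = y ^+ n.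
  by rewrite det_lblock det1 mul1r det_scalar.
rewrite -detM -det_mulmx mulmx_block !mul1mx !mul0mx !addr0 mulmx1.
rewrite mul_mx_scalar mul_scalar_mx scalerN addNr mulNmx addrC.
by rewrite det_ublock det_scalar.
Qed.

Lemma char_poly_add1 (R : comNzRingType) (n : nat) (A : 'M[R]_n) :
  char_poly A = \det ((1 + 'X)%:M - map_mx polyC (A + 1%:M)).
Proof.
congr (\det _).
rewrite /char_poly_mx map_mxD map_scalar_mx rmorph1 opprD.
by rewrite [(1 + 'X)%:M]raddfD /= [1%:M + _]addrC addrACA subrr addr0.
Qed.

(** * Factoring both matrices through the cyclic subgroups *)

Section CyclicSubgroups.
Variables (gT : finGroupType) (l : nat) (S : 'I_l -> {group gT}).
Hypothesis S_inj : injective S.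
Hypothesis S_cyclic : forall C : {group gT}, cyclic C <-> exists i, S i = C.

Let comparable (A B : {set gT}) := (A \subset B) || (B \subset A).

Lemma cycle_in_list (x : gT) : exists i, S i = <[x]>%G.
Proof. exact/S_cyclic/cycle_cyclic. Qed.

Lemma generator_in_list (i : 'I_l) : exists x, S i = <[x]>%G.
Proof.
have /cyclicP[x Sx] : cyclic (S i) by apply/S_cyclic; exists i.
by exists x; apply: val_inj.
Qed.

Lemma card_generators (i : 'I_l) : #|generators (S i)| = totient #|S i|.
Proof. by have [x ->] := generator_in_list i; rewrite -totient_gen. Qed.

Lemma generator_eq (i j : 'I_l) (x : gT) :
  S i = <[x]>%G -> generator (S j) x = (i == j).
Proof.
move=> Si; rewrite /generator -(inj_eq S_inj) Si.
by apply/eqP/eqP=> [E|<-//]; apply: val_inj.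
Qed.

(** For distinct vertices, adjacency only compares the subgroups they generate, and every [S i] has
    a generator to test it on. Without [i != j] it fails, as no vertex is adjacent to itself. *)
Lemma fully_adjacent_generators (i j : 'I_l) : i != j ->
  fully_adjacent (generators (S i)) (generators (S j)) = comparable (S i) (S j).
Proof.
move=> neq_ij; apply/forall_inP/idP=> [adjS | cmpS x].
  have [x Sx] := generator_in_list i; have [y Sy] := generator_in_list j.
  have /forall_inP/(_ y) : [forall y in generators (S j), power_adj x y].
    by apply: adjS; rewrite inE Sx generator_cycle.
  rewrite inE Sy generator_cycle => /(_ isT) /andP[_].
  by rewrite /comparable Sx !cycle_subG.
rewrite inE => /eqP Sx; apply/forall_inP=> y; rewrite inE => /eqP Sy.
change (power_adj x y); rewrite /power_adj; apply/andP; split.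
  apply: contraNneq neq_ij => xy; apply/eqP/S_inj/val_inj.
  by rewrite /= Sx Sy xy.
by move: cmpS; rewrite /comparable Sx Sy !cycle_subG.
Qed.

Let U : 'M[int]_(#|power_graph gT|, l) :=
  \matrix_(a, i) (generator (S i) (enum_val a : gT))%:R.
Let V : 'M[int]_(l, #|power_graph gT|) :=
  \matrix_(i, a) (comparable (S i) <[enum_val a : gT]>%g)%:R.

(** Row [a] of [U] has a single 1, at the subgroup generated by [a], so the product tests
    comparability of two generated subgroups; the identity matrix supplies the diagonal. *)
Lemma adjacency_matrix_add1 : adjacency_matrix (power_graph gT) + 1%:M = U *m V.
Proof.
apply/matrixP=> a b; rewrite !mxE.
have [i Si] := cycle_in_list (enum_val a : gT).
rewrite (bigD1 i) //= !mxE (generator_eq i Si) eqxx mul1r Si big1 ?addr0.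
  rewrite /comparable !cycle_subG /= /power_adj (inj_eq enum_val_inj).
  by have [->|_] := eqVneq; rewrite /= ?cycle_id ?add0r ?addr0.
by move=> j neq_ji; rewrite !mxE (generator_eq j Si) eq_sym (negPf neq_ji) mul0r.
Qed.

(** Entry [(i, j)] of [V *m U] adds one constant, the comparability of [S i] and [S j], over the
    generators of [S j]. *)
Lemma quotient_matrix_add1 : quotient_matrix S + 1%:M = V *m U.
Proof.
apply/matrixP=> i j; rewrite !mxE.
transitivity (\sum_(x in generators (S j)) (comparable (S i) (S j))%:R : int).
  rewrite sumr_const card_generators.
  have [->|neq_ij] := eqVneq i j.
    by rewrite /= subrK /comparable subxx.
  by rewrite /= addr0 fully_adjacent_generators //; case: comparable; rewrite ?mul0rn.
rewrite big_mkcond (reindex _ (onW_bij _ (@enum_val_bij (power_graph gT)))) /=.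
apply: eq_bigr => a _; rewrite !mxE inE /generator.
by case: eqP => [<-|_]; rewrite ?mulr1 ?mulr0.
Qed.

Lemma char_poly_power_graph :
  (1 + 'X) ^+ l * char_poly (adjacency_matrix (power_graph gT)) =
  (1 + 'X) ^+ #|gT| * char_poly (quotient_matrix S).
Proof.
rewrite !char_poly_add1 adjacency_matrix_add1 quotient_matrix_add1 !map_mxM.
exact: det_scalar_sub_mulmxC.
Qed.

(** Double counting: each element generates exactly one [S i], whose size is its order. *)
Lemma card_order_eq (m : nat) :
  #|[set x : gT | #[x]%g == m]| = (#|[set i | #|S i| == m]| * totient m)%N.
Proof.
rewrite -!sum1dep_card big_distrl /= (big_mkcond (fun x : gT => #[x]%g == m)).
rewrite [RHS]big_mkcond /=.
transitivity (\sum_(x : gT) \sum_i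
    (if #|S i| == m then (x \in generators (S i)) : nat else 0))%N.
  apply: eq_bigr => x _; have [i Si] := cycle_in_list x.
  rewrite (bigD1 i) //= Si inE generator_cycle big1 ?addn0 // => j.
  by rewrite eq_sym => /negPf neq_ij; rewrite inE (generator_eq j Si) neq_ij if_same.
rewrite exchange_big; apply: eq_bigr => i _ /=; case: eqP => [<-|_].
  by rewrite -card_generators mul1n -sum1_card [RHS]big_mkcond.
by rewrite big1.
Qed.

End CyclicSubgroups.

(** * Elements of given order in a direct product *)

Section DirectProduct.
Variables (aT bT : finGroupType).

Lemma expg_pair (x : aT) (y : bT) (m : nat) :
  ((x, y) ^+ m = (x ^+ m, y ^+ m) :> aT * bT)%g.
Proof. by elim: m => // m IHm; rewrite !expgS IHm. Qed.

Lemma order_pair (x : aT) (y : bT) :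
  #[(x, y) : aT * bT]%g = lcmn #[x]%g #[y]%g.
Proof.
apply/eqP; rewrite eqn_dvd dvdn_lcm !order_dvdn expg_pair; apply/andP; split.
  by apply/eqP; congr (_, _); apply/eqP; rewrite -order_dvdn ?dvdn_lcml ?dvdn_lcmr.
have := expg_order ((x, y) : aT * bT); rewrite expg_pair => -[-> ->].
by rewrite !eqxx.
Qed.

End DirectProduct.

(** The subgroup of order [m] is unique, so the elements of order [m] are its generators. *)
Lemma card_order_eq_cyclic (gT : finGroupType) (m : nat) :
  cyclic [set: gT] -> (m %| #|gT|)%N -> #|[set x : gT | #[x]%g == m]| = totient m.
Proof.
case/cyclicP=> a defT; rewrite -cardsT defT => dvd_m.
have := cycle_sub_group dvd_m; set b := (a ^+ _)%g => subs.
have ob : #[b]%g = m 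
  by have := set11 <[b]>%G; rewrite -subs inE => /andP[_ /eqP].
rewrite -{2}ob totient_gen; apply: eq_card => x; rewrite !inE.
apply/eqP/eqP=> [ox|defb]; last by rewrite -ob /order defb.
have : <[x]>%G \in [set H : {group gT} | H \subset <[a]>%g & #|H| == m].
  by rewrite inE -defT subsetT -ox eqxx.
by rewrite subs inE => /eqP/(congr1 val).
Qed.

(** The pairs with first component 1 number [totient m]. Each of the other [p - 1] first components
    has order [p] and leaves the [y] with [lcmn p #[y] = m] to count. *)
Lemma card_order_eq_prime_prod (aT bT : finGroupType) (m : nat) :
  prime #|aT| -> cyclic [set: bT] -> (m %| #|bT|)%N ->
  #|[set z : aT * bT | #[z]%g == m]| =
  ((if #|aT| ^ 2 %| m then #|aT| else if #|aT| %| m then #|aT| + 1 else 1)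
   * totient m)%N.
Proof.
set p := #|aT| => prp cycb dvdm.
rewrite -sum1dep_card (eq_bigl (fun z => (lcmn #[z.1]%g #[z.2]%g == m))); last first.
  by case=> x y; rewrite order_pair.
rewrite -(pair_big_dep xpredT (fun (x : aT) (y : bT) => lcmn #[x]%g #[y]%g == m) (fun _ _ => 1%N)) /=.
rewrite (bigD1 1%g) //= order1.
rewrite (eq_bigl (fun y : bT => #[y]%g == m)) => [|y]; last by rewrite lcm1n.
rewrite sum1dep_card card_order_eq_cyclic //.
rewrite (eq_bigr (fun=> #|[set y : bT | lcmn p #[y]%g == m]|)); last first.
  move=> x ntx; rewrite -sum1dep_card; apply: eq_bigl => y; congr (lcmn _ _ == m).
  have := order_dvdG (in_setT x); rewrite cardsT => /(prime_nt_dvdP prp) -> //.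
  by rewrite order_eq1.
rewrite sum_nat_const (cardC1 _ : _ = p.-1).
have lcm_p o : lcmn p o = if (p %| o)%N then o else (p * o)%N.
  case: ifPn => [/lcmn_idPr // | ndiv_po].
  by rewrite -[RHS]muln_lcm_gcd (eqP (_ : coprime p o)) ?muln1 // prime_coprime.
have [/dvdnP[q def_m] | ndiv_pm] := boolP (p %| m)%N; last first.
  rewrite [X in (_ * X)%N]eq_card0 => [|y]; last first.
    by rewrite !inE; apply: contraNF ndiv_pm => /eqP<-; apply: dvdn_lcml.
  rewrite muln0 addn0 ifF ?mul1n //; apply: contraNF ndiv_pm.
  by apply: dvdn_trans; apply: dvdn_mulr.
have p_gt0 := prime_gt0 prp; rewrite mulnC in def_m.
have dvdq : (q %| #|bT|)%N by apply: dvdn_trans dvdm; rewrite def_m dvdn_mull.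
rewrite def_m expnS expn1 dvdn_pmul2l // -def_m.
(* Here [m = p * q]. An order prime to [p] would have to be [q], so if [p] divides [q] only order
   [m] is possible; otherwise both [m] and [q] occur. *)
have [div_pq | ndiv_pq] := boolP (p %| q)%N.
  rewrite (eq_card (B := [set y : bT | #[y]%g == m])) => [|y].
    by rewrite card_order_eq_cyclic // -mulSn prednK.
  rewrite !inE lcm_p; case: ifPn => // ndiv_py; apply/eqP/eqP.
    by rewrite def_m => /eqP; rewrite eqn_pmul2l // => /eqP oy; rewrite oy div_pq in ndiv_py.
  by move=> oy; rewrite oy def_m dvdn_mulr in ndiv_py.
rewrite (eq_card (B := [set y : bT | #[y]%g == m] :|: [set y | #[y]%g == q])) => [|y].
  rewrite cardsU (_ : _ :&: _ = set0) ?cards0 ?subn0; last first.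
    apply/setP=> y; rewrite !inE; apply/andP=> -[/eqP-> /eqP eq_mq].
    by rewrite -eq_mq def_m dvdn_mulr in ndiv_pq.
  (* The elements of order [q] give the extra term [(p - 1) * totient q], which is [totient m] since
     [p] and [q] are coprime. *)
  rewrite !card_order_eq_cyclic // mulnDr addnA -mulSn prednK // mulnDl mul1n.
  congr (_ + _)%N.
  by rewrite def_m totient_coprime ?prime_coprime // (totient_prime prp).
rewrite !inE lcm_p; case: ifPn => [div_py | ndiv_py].
  by case: (#[y]%g =P q) => [oy|_]; rewrite ?orbF // -oy div_py in ndiv_pq *.
rewrite {1}def_m eqn_pmul2l //.
by case: (#[y]%g =P m) => [oy|//]; rewrite oy def_m dvdn_mulr in ndiv_py.
Qed.

(** * Sums over the divisors of [n] *)

(** The number of cyclic subgroups of order [d i], read off from the position of [i]. *)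
Definition weight (p r t i : nat) : nat :=
  if (i < r)%N then p else if (i < r + t)%N then (p + 1)%N else 1%N.

Lemma sum_three_blocks (p k r t : nat) (F : 'I_k -> nat) :
  (\sum_(i < k) weight p r t i * F i =
   p * (\sum_(i < k | i < r) F i) + (p + 1) * (\sum_(i < k | r <= i < r + t) F i)
   + \sum_(i < k | r + t <= i) F i)%N.
Proof.
rewrite (big_mkcond (fun i : 'I_k => i < r)%N) /=.
rewrite (big_mkcond (fun i : 'I_k => r <= i < r + t)%N) /=.
rewrite (big_mkcond (fun i : 'I_k => r + t <= i)%N) /= !big_distrr -!big_split /=.
by apply: eq_bigr => i _; rewrite /weight; case: (ltnP i r) => ?; case: (ltnP i (r + t)) => ? /=; lia.
Qed.

Lemma alpha_add_block_count (p k r t : nat) (d : 'I_k -> nat) :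
  (forall i, 0 < d i)%N ->
  (alpha p r t d + \sum_(i < k) weight p r t i
   = \sum_(i < k) weight p r t i * totient (d i))%N.
Proof.
move=> d_gt0; rewrite /alpha -sum_three_blocks -big_split.
apply: eq_bigr => i _ /=; rewrite -[X in (_ + X)%N]muln1 -mulnDr subnK //.
by rewrite totient_gt0.
Qed.

Lemma block_count (p k r t : nat) : (r + t <= k)%N ->
  (\sum_(i < k) weight p r t i =
   p * r + (p + 1) * t + (k - r - t))%N.
Proof.
move=> le_k.
(* Generalised to prefixes of any length [j], so that induction can cross the block boundaries. *)
suff /(_ k) -> : forall j, (\sum_(i < j) weight p r t i =
    p * minn j r + (p + 1) * (minn j (r + t) - r) + (j - (r + t)))%N.
  by congr (_ * _ + _ * _ + _)%N; lia.
elim=> [|j IHj]; first by rewrite big_ord0; lia.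
rewrite big_ord_recr /= IHj /weight.
case: (ltnP j r) => ?; [|case: (ltnP j (r + t)) => ?].
- have [-> -> ->] : [/\ minn j.+1 r = (minn j r).+1,
    minn j.+1 (r + t) - r = minn j (r + t) - r
    & j.+1 - (r + t) = j - (r + t)]%N by split; lia.
  lia.
- have [-> -> ->] : [/\ minn j.+1 r = minn j r,
    minn j.+1 (r + t) - r = (minn j (r + t) - r).+1
    & j.+1 - (r + t) = j - (r + t)]%N by split; lia.
  lia.
have [-> ->] : minn j.+1 r = minn j r /\ minn j.+1 (r + t) = minn j (r + t).
  by split; lia.
lia.
Qed.

(** Ensures that every element order occurs among the [d i]. *)
Lemma order_ZpxZn_dvd (p n : nat) (x : ZpxZn p n) :
  prime p -> (0 < n)%N -> (p %| n)%N -> (#[x]%g %| n)%N.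
Proof.
case: x => a b p_prime n_gt0 p_dvd_n; have p_gt1 := prime_gt1 p_prime.
have n_gt1 : (1 < n)%N by apply: leq_trans p_gt1 (dvdn_leq n_gt0 p_dvd_n).
have := order_dvdG (in_setT a); have := order_dvdG (in_setT b).
rewrite !cardsT !card_ord !Zp_cast // => bn ap.
by rewrite order_pair dvdn_lcm (dvdn_trans ap).
Qed.

Theorem theorem3p2 (p n : nat) (p_prime : prime p) (n_gt0 : (0 < n)%N)
    (p_dvd_n : (p %| n)%N)
    (k r t : nat) (d : 'I_k -> nat)
    (d_inj : injective d)
    (d_divisors : forall m : nat, (m %| n)%N <-> exists i, d i = m)
    (rt_le_k : (r + t <= k)%N)
    (d_head : forall i : 'I_k, (i < r)%N <-> (p ^ 2 %| d i)%N)
    (d_mid : forall i : 'I_k,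
      (r <= i < r + t)%N <-> (p %| d i)%N /\ ~ (p ^ 2 %| d i)%N)
    (d_tail : forall i : 'I_k, (r + t <= i)%N <-> coprime (d i) p)
    (l : nat) (S : 'I_l -> {group ZpxZn p n})
    (S_inj : injective S)
    (S_cyclic : forall C : {group ZpxZn p n}, cyclic C <-> exists i, S i = C) :
  l = (p * r + (p + 1) * t + (k - r - t))%N /\
  char_poly (adjacency_matrix (power_graph (ZpxZn p n))) =
    (1 + 'X) ^+ alpha p r t d * char_poly (quotient_matrix S).
Proof.
have p_gt1 := prime_gt1 p_prime.
have n_gt1 : (1 < n)%N by apply: leq_trans p_gt1 (dvdn_leq n_gt0 p_dvd_n).
have cardp : #|'Z_p| = p by rewrite card_ord Zp_cast.
have cardn : #|'Z_n| = n by rewrite card_ord Zp_cast.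
pose c (i : 'I_k) := weight p r t i%N.
have d_dvd i : (d i %| n)%N by apply/d_divisors; exists i.
have d_gt0 i : (0 < d i)%N by apply: dvdn_gt0 (d_dvd i).
have cE i : c i = (if p ^ 2 %| d i then p else if p %| d i then p + 1 else 1)%N.
  rewrite /c /weight; case: ltnP => [/d_head -> // | le_ri].
  case: ltnP => [lt_i | /d_tail]; last first.
    rewrite coprime_sym prime_coprime // => ndiv; rewrite (negPf ndiv) ifF //.
    by apply: contraNF ndiv; apply: dvdn_trans; apply: dvdn_mulr.
  have [-> /negP/negPf -> //] : (p %| d i)%N /\ ~ (p ^ 2 %| d i)%N.
  by apply/d_mid; rewrite le_ri.
have cycn : cyclic [set: 'Z_n].
  by apply/cyclicP; exists Zp1; apply: Zp_cycle.
have card_o i : #|[set x : ZpxZn p n | #[x]%g == d i]| = (c i * totient (d i))%N.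
  rewrite cE; have := @card_order_eq_prime_prod ('Z_p) ('Z_n) (d i).
  by rewrite cardp cardn; apply.
(* Cancel [totient (d i)] between the two counts of the elements of order [d i]. *)
have card_S i : #|[set j | #|S j| == d i]| = c i.
  apply/eqP; rewrite -(@eqn_pmul2r (totient (d i))) ?totient_gt0 //.
  by rewrite -(card_order_eq S_inj S_cyclic) card_o.
have order_div (x : ZpxZn p n) : exists i, d i == #[x]%g.
  by have /d_divisors[i <-] := order_ZpxZn_dvd x p_prime n_gt0 p_dvd_n; exists i.
have card_div j : exists i, d i == #|S j|.
  have [x ->] := generator_in_list S_cyclic j.
  by have [i di] := order_div x; exists i.
(* Elements and listed subgroups are sorted by the index of their order; as [d] is injective, the
   fibres are the sets just counted. *)
pose f x := xchoose (order_div x); pose g j := xchoose (card_div j).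
have fP x : d (f x) = #[x]%g by apply/eqP/(xchooseP (order_div x)).
have gP j : d (g j) = #|S j| by apply/eqP/(xchooseP (card_div j)).
have sum_c : \sum_i c i = l.
  rewrite -[RHS]card_ord -sum1_card (partition_big g xpredT) //=.
  apply: eq_bigr => i _; rewrite -card_S -sum1dep_card; apply: eq_bigl => j.
  by rewrite -(inj_eq d_inj) gP.
have sum_ct : (\sum_i c i * totient (d i) = #|ZpxZn p n|)%N.
  rewrite -sum1_card (partition_big f xpredT) //=.
  apply: eq_bigr => i _; rewrite -card_o -sum1dep_card; apply: eq_bigl => x.
  by rewrite -(inj_eq d_inj) fP.
have := alpha_add_block_count p r t d_gt0.
rewrite sum_ct [X in (_ + X)%N]sum_c => alphaE.
split; first by rewrite -block_count.
(* Since [alpha + l] is the group order, it remains to cancel [(1 + 'X) ^+ l] in the integral domain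
   of integer polynomials. *)
have y_neq0 : (1 + 'X : {poly int}) ^+ l != 0.
  by rewrite expf_neq0 // addrC -(opprK 1) -polyCN polyXsubC_eq0.
apply: (mulfI y_neq0); rewrite (char_poly_power_graph S_inj S_cyclic) mulrA.
by rewrite -exprD addnC alphaE.
Qed.
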